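(* Let $\mathcal{S}$ be a finite nonempty set, let $\Delta$ be the probability simplex of beliefs on $\mathcal{S}$, let $k$ be a positive semidefinite kernel on $\Delta$, and let $\bm{b}_1,\dots,\bm{b}_m\in\Delta$. Suppose that the convex hull upper bound $h$ is modelled as a zero-mean Gaussian process on $\Delta$ with covariance kernel $k$, and that the sawtooth projections satisfy $\overline{v}(\bm{b}_i)=h(\bm{b}_i)+\epsilon_i$ for $i=1,\dots,m$, where $\epsilon_1,\dots,\epsilon_m$ are independent $\mathcal{N}(0,\sigma_\epsilon^2)$ random variables, independent of $h$, with $\sigma_\epsilon^2>0$. Let $\mu(\bm{b})$ and $\sigma(\bm{b})\ge 0$ be the Gaussian process posterior mean and posterior standard deviation at $\bm{b}\in\Delta$ given $\overline{\bm{v}}_m=(\overline{v}(\bm{b}_1),\dots,\overline{v}(\bm{b}_m))^T$, let $\eta>0$ be the confidence parameter, and let $\overline{V}_{UCB}(\bm{b})=\mu(\bm{b})+\eta\,\sigma(\bm{b})$ be the upper confidence bound. Then for every belief point $\bm{b}\in\Delta$, with $P$ denoting probability conditional on $\overline{\bm{v}}_m$, $$P\left(h(\bm{b})\le \overline{V}_{UCB}(\bm{b})\right)\ge \frac{1}{\sqrt{2\pi}}\,e^{-\eta^2/2}.$$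
   Context: Beliefs: for a finite state set $\mathcal{S}$, a belief is a vector $\bm{b}=(b(s))_{s\in\mathcal{S}}$ with $b(s)\ge 0$ and $\sum_{s}b(s)=1$; $\Delta$ denotes the set of beliefs. Upper bounds: in point-based value iteration for a partially observable Markov decision process, given a finite set of beliefs (containing all unit vectors $\bm{w}_s$) with known upper bounds on the convex value function, $h(\bm{b})$ denotes the convex hull upper bound at $\bm{b}$, i.e. the smallest value of a convex combination of the known upper bounds over all representations of $\bm{b}$ as the same convex combination of the corresponding beliefs. The sawtooth projection $\overline{v}(\bm{b})$ is a cheaper approximation of $h(\bm{b})$. In the Gaussian process regression model, $h$ is treated as an unknown random function with a zero-mean Gaussian process prior, and the sawtooth projections are treated as noisy observations $\overline{v}(\bm{b}_i)=h(\bm{b}_i)+\epsilon_i$ with $\epsilon_i\sim\mathcal{N}(0,\sigma_\epsilon^2)$. Posterior: let $\mathbf{K}_m$ be the $m\times m$ matrix with entries $k(\bm{b}_i,\bm{b}_j)$, let $\mathbf{k}_m(\bm{b})=(k(\bm{b}_1,\bm{b}),\dots,k(\bm{b}_m,\bm{b}))^T$, and let $\mathbf{I}$ be the identity matrix. Then $$\mu(\bm{b})=\mathbf{k}_m(\bm{b})^T[\mathbf{K}_m+\sigma_\epsilon^2\mathbf{I}]^{-1}\overline{\bm{v}}_m,\qquad \sigma^2(\bm{b})=k(\bm{b},\bm{b})-\mathbf{k}_m(\bm{b})^T[\mathbf{K}_m+\sigma_\epsilon^2\mathbf{I}]^{-1}\mathbf{k}_m(\bm{b}).$$ *)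

(* Defs.v *)
From HB Require Import structures.
From mathcomp Require Import all_boot all_order all_algebra.
From mathcomp Require Import all_classical all_reals all_analysis.

Set Implicit Arguments.
Unset Strict Implicit.
Unset Printing Implicit Defensive.

Import Order.TTheory GRing.Theory Num.Theory.
Import numFieldNormedType.Exports.

Local Open Scope classical_set_scope.
Local Open Scope ring_scope.

(* The simplex of probability vectors indexed by S. *)
Definition belief (R : realType) (S : finType) : Type :=
  {b : {ffun S -> R} | [forall s, 0 <= b s] && (\sum_s b s == 1)}.

Section kernel_regression.
Context {R : realType} {T : Type}.
Implicit Types (k : T -> T -> R) (t : T).

Definition psd_kernel k : Prop :=
  (forall t u, k t u = k u t) /\
  (forall (n : nat) (x : 'I_n -> T) (c : 'I_n -> R),
     0 <= \sum_i \sum_j c i * c j * k (x i) (x j)).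

Definition gram_mx k n (x : 'I_n -> T) : 'M[R]_n := \matrix_(i, j) k (x i) (x j).

Definition kernel_vec k n (x : 'I_n -> T) t : 'cV[R]_n := \col_i k (x i) t.

(* [s2] is the noise variance, [x] the observation points and [y] the observed
   values. *)
Definition post_mean k (s2 : R) n (x : 'I_n -> T) (y : 'cV[R]_n) t : R :=
  ((kernel_vec k x t)^T *m invmx (gram_mx k x + s2%:M) *m y) 0 0.

Definition post_var k (s2 : R) n (x : 'I_n -> T) t : R :=
  k t t -
  ((kernel_vec k x t)^T *m invmx (gram_mx k x + s2%:M) *m kernel_vec k x t) 0 0.

Definition post_sd k (s2 : R) n (x : 'I_n -> T) t : R :=
  Num.sqrt (post_var k s2 x t).

Definition ucb k (s2 eta : R) n (x : 'I_n -> T) (y : 'cV[R]_n) t : R :=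
  post_mean k s2 x y t + eta * post_sd k s2 x t.

End kernel_regression.

Section random_families.
Context {d : measure_display} {Omega : measurableType d} {R : realType}
  (P : probability Omega R).

(* In [normal_prob m s] the parameter [s] is a standard deviation; only for
   [s != 0] is this a Gaussian law (the library makes [normal_prob m 0] the
   uniform law on [0, 1]). *)
Definition normal_rv (X : {RV P >-> R}) (m s : R) : Prop :=
  forall B : set R, measurable B -> distribution P X B = normal_prob m s B.

(* Subfamilies are covered by taking [B i = setT] outside of them. *)
Definition mutually_independent n (X : 'I_n -> {RV P >-> R}) : Prop :=
  forall B : 'I_n -> set R, (forall i, measurable (B i)) ->
    P (\bigcap_i (X i @^-1` B i)) = (\prod_(i < n) P (X i @^-1` B i))%E.

Definition sigma_of (I : Type) (X : I -> {RV P >-> R}) : set (set Omega) :=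
  <<s \bigcup_i preimage_set_system setT (X i) measurable >>.

Definition independent_families (I J : Type) (X : I -> {RV P >-> R})
    (Y : J -> {RV P >-> R}) : Prop :=
  forall E F : set Omega, sigma_of X E -> sigma_of Y F ->
    P (E `&` F) = (P E * P F)%E.

(* [Q] is a version of the conditional probability of the event [E] given the
   sigma-algebra [G] (a sub-sigma-algebra of the measurable sets). *)
Definition is_cond_prob (G : set (set Omega)) (E : set Omega) (Q : Omega -> R) :
    Prop :=
  [/\ forall B : set R, measurable B -> G (Q @^-1` B),
      P.-integrable setT (EFin \o Q) &
      forall A : set Omega, G A ->
        (\int[P]_(w in A) (Q w)%:E)%E = P (E `&` A)].

End random_families.

(* X ~ N(m, Sigma), possibly degenerate: X has the law of m + A xi for a vector
   xi of independent standard normal variables and some A with A A^T = Sigma. *)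
Definition gaussian_vector d (Omega : measurableType d) (R : realType)
    (P : probability Omega R) n (X : 'I_n -> {RV P >-> R})
    (m : 'cV[R]_n) (Sigma : 'M[R]_n) : Prop :=
  exists (d' : measure_display) (Omega' : measurableType d')
    (P' : probability Omega' R) (r : nat) (xi : 'I_r -> {RV P' >-> R})
    (A : 'M[R]_(n, r)),
    [/\ A *m A^T = Sigma,
        mutually_independent xi,
        forall j, normal_rv (xi j) 0 1 &
        forall B : set (n.-tuple R), measurable B ->
          P [set w | B [tuple X i w | i < n]] =
          P' [set w | B [tuple m i 0 + \sum_j A i j * xi j w | i < n]]].

Definition centered_gaussian_process d (Omega : measurableType d)
    (R : realType) (P : probability Omega R) (T : Type)
    (h : T -> {RV P >-> R}) (k : T -> T -> R) : Prop :=
  forall n (x : 'I_n -> T),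
    gaussian_vector (fun i => h (x i)) 0 (gram_mx k x).

(* Main.v *)
(* Let Z = h(b) - mu(b) be the residual of the posterior mean.  It is Gaussian,
   centered and uncorrelated with every observation, so (Z, v) and (-Z, v) have
   the same law.  Hence P(Z <= 0, A) = P(Z >= 0, A) >= P(A) / 2 for every event A
   of the sigma-algebra of v, and since Z <= 0 entails h(b) <= UCB(b), the
   conditional probability is almost surely at least 1/2, which exceeds
   e^(-eta^2/2) / sqrt(2 pi) because pi >= 2.

   The symmetry is obtained from the rotation invariance of the standard Gaussian
   law: in terms of independent standard normal variables (the ones representing
   h, together with the rescaled noise), Z = c.g and v = B g with B c = 0;
   plane rotations bring c onto a coordinate axis, whose coordinate is then
   symmetric and independent of v. *)
Require Import Defs.
From HB Require Import structures.
From mathcomp Require Import all_boot all_order all_algebra.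
From mathcomp Require Import all_classical all_reals all_analysis.
From mathcomp Require Import measurable_realfun ring lra.
Import Order.TTheory GRing.Theory Num.Theory.
Import numFieldNormedType.Exports.
Local Open Scope classical_set_scope.
Local Open Scope ring_scope.
Set Implicit Arguments.
Unset Strict Implicit.
Unset Printing Implicit Defensive.

(** * Measures determined by a generating pi-system *)

Lemma measurable_preimage d1 d2 (T1 : sigmaRingType d1) (T2 : sigmaRingType d2)
    (f : T1 -> T2) (A : set T2) :
  measurable [set: T1] -> measurable_fun setT f -> measurable A ->
  measurable (f @^-1` A).
Proof. by move=> mT mf mA; rewrite -[X in measurable X]setTI; exact: mf. Qed.

(** Measurable rectangles are closed under intersection and generate the product sigma-algebra; the
    finite total mass lets uniqueness of measures apply. *)
Lemma eq_measure_rectangles d1 d2 (T1 : measurableType d1)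
    (T2 : measurableType d2) (R : realType)
    (m1 m2 : {measure set (T1 * T2) -> \bar R}) :
  (m1 setT < +oo)%E ->
  (forall A B, measurable A -> measurable B -> m1 (A `*` B) = m2 (A `*` B)) ->
  forall D, measurable D -> m1 D = m2 D.
Proof.
move=> m1oo m12 D mD.
pose C : set (set (T1 * T2)) :=
  [set A `*` B | A in measurable & B in measurable].
apply: (measure_unique C (fun=> setT)) => //.
- by rewrite measurable_prod_measurableType.
- move=> _ _ [A mA [B mB <-]] [A' mA' [B' mB' <-]].
  exists (A `&` A'); first exact: measurableI.
  by exists (B `&` B'); [exact: measurableI|rewrite setXI].
- by move=> _; exists setT => //; exists setT => //; rewrite setXTT.
- by rewrite bigcup_const.
- by move=> _ [A mA [B mB <-]]; exact: m12.
Qed.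

(* The boxes [\bigcap_i X i @^-1` B i] form a pi-system generating the
   sigma-algebra of the family [X]. *)
Lemma eq_measure_boxes d (Omega : measurableType d) (R : realType)
    (I : finType) (X : I -> Omega -> R) (m1 m2 : {measure set Omega -> \bar R}) :
  (forall i, measurable_fun setT (X i)) ->
  (m1 setT < +oo)%E ->
  (forall B : I -> set R, (forall i, measurable (B i)) ->
    m1 (\bigcap_i (X i @^-1` B i)) = m2 (\bigcap_i (X i @^-1` B i))) ->
  forall A, <<s \bigcup_i preimage_set_system setT (X i) measurable >> A ->
    m1 A = m2 A.
Proof.
move=> mX m1oo m12 A sA.
pose G : set (set Omega) :=
  [set \bigcap_i (X i @^-1` B i) | B in [set B : I -> set R |
     forall i, measurable (B i)]].
apply: (g_sigma_algebra_measure_unique G _ (fun=> setT)) => //.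
- move=> _ [B mB <-]; apply: fin_bigcap_measurable => // i _.
  by rewrite -[X in measurable X]setTI; exact: mX.
- move=> _; exists (fun=> setT) => //.
  by rewrite -subTset => w _ i _.
- by rewrite bigcup_const.
- move=> _ _ [B mB <-] [B' mB' <-]; exists (fun i => B i `&` B' i).
    by move=> i; exact: measurableI.
  by rewrite -bigcapI; apply: eq_bigcapr => i _; rewrite preimage_setI.
- by move=> _ [B mB <-]; exact: m12.
- move: A sA; apply: sub_smallest2r => //; last first.
    move=> _ [i _ [B mB <-]]; exists (fun j => if j == i then B else setT).
      by move=> j; case: ifP.
    rewrite setTI; apply/seteqP; split => w /=.
      by move=> /(_ i Logic.I); rewrite eqxx.
    by move=> Bw j _; have [->//|ji] := eqVneq j i.
Qed.

(** * Lebesgue integrals under affine maps, shears and plane rotations *)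

Section lebesgue_affine.
Context {R : realType}.
Local Notation mu := (@lebesgue_measure R).
Local Open Scope ereal_scope.

Lemma measurable_affine (s t : R) :
  measurable_fun setT
    (fun x : measurableTypeR R => (s * x + t)%R : measurableTypeR R).
Proof.
by apply: (@measurable_funD _ (measurableTypeR R)) => //; exact: measurable_funM.
Qed.

(** The pushforward by the affine map, multiplied by [s], gives each half-open interval its length,
    hence is Lebesgue measure by uniqueness. *)
Lemma lebesgue_measure_affine (s t : R) (A : set R) : (0 < s)%R ->
  measurable A ->
  mu ((fun x => s * x + t)%R @^-1` A) = s^-1%:E * mu A.
Proof.
move=> s0 mA.
pose f (x : measurableTypeR R) : measurableTypeR R := (s * x + t)%R.
have mf : measurable_fun setT f := measurable_affine s t.
pose s_ : {nonneg R} := NngNum (ltW s0).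
suff -> : mu A = s%:E * mu (f @^-1` A).
  by rewrite muleA -EFinM mulVf ?gt_eqF// mul1e.
apply: (lebesgue_measure_unique (mu := mscale s_ (pushforward mu f))) => //.
move=> _ [[a b]] _ <-.
change (mu `]a, b]%classic%R = s%:E * mu (f @^-1` [set` `]a, b]%R])).
have -> : f @^-1` [set` `]a, b]%R] = [set` `](a - t) / s, (b - t) / s]%R].
  apply/seteqP; split => x /=; rewrite !in_itv/=.
    by rewrite ltr_pdivrMr// ler_pdivlMr// ltrBlDr lerBrDr ![(x * s)%R]mulrC.
  by rewrite ltr_pdivrMr// ler_pdivlMr// ltrBlDr lerBrDr ![(x * s)%R]mulrC.
rewrite !lebesgue_measure_itv/= !lte_fin ltr_pM2r ?invr_gt0// ltrD2r.
case: ifP => _; last by rewrite mule0.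
by rewrite -!EFinB -EFinM; congr EFin; field; rewrite gt_eqF.
Qed.

Lemma ge0_integral_affine (s t : R) (f : R -> \bar R) : (0 < s)%R ->
  measurable_fun setT f -> (forall x, 0 <= f x) ->
  \int[mu]_x f (s * x + t)%R = s^-1%:E * \int[mu]_x f x.
Proof.
move=> s0 mf f0.
pose g : R -> measurableTypeR R := fun x => (s * x + t)%R.
have mg : measurable_fun setT g by exact: measurable_affine.
have si0 : (0 <= s^-1)%R by rewrite invr_ge0 ltW.
transitivity (\int[pushforward mu g]_x f x).
  by rewrite ge0_integral_pushforward// preimage_setT.
rewrite (eq_measure_integral (mscale (NngNum si0) mu)); last first.
  by move=> A mA _; exact: lebesgue_measure_affine.
by rewrite ge0_integral_mscale.
Qed.

(** By Tonelli, with the unsheared coordinate outermost, a shear is a mere translation in the inner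
    integral. *)
Lemma ge0_integral_shear (a : R) (f : R * R -> \bar R) :
  measurable_fun setT f -> (forall p, 0 <= f p) ->
  \int[mu \x mu]_p f (p.1, p.2 + a * p.1)%R = \int[mu \x mu]_p f p /\
  \int[mu \x mu]_p f (p.1 + a * p.2, p.2)%R = \int[mu \x mu]_p f p.
Proof.
move=> mf f0; split.
- rewrite fubini_tonelli1//; last first.
    apply: (measurableT_comp mf); apply: measurable_fun_pair => //.
    by apply: measurable_funD => //; exact: measurable_funM.
  rewrite [RHS]fubini_tonelli1//; apply: eq_integral => x _.
  rewrite /fubini_F/=.
  have := @ge0_integral_affine 1 (a * x) (fun y => f (x, y)) ltr01.
  rewrite invr1 mul1e => <-//; last exact: measurableT_comp.
  by apply: eq_integral => y _; rewrite mul1r.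
- rewrite fubini_tonelli2//; last first.
    apply: (measurableT_comp mf); apply: measurable_fun_pair => //.
    by apply: measurable_funD => //; exact: measurable_funM.
  rewrite [RHS]fubini_tonelli2//; apply: eq_integral => y _.
  rewrite /fubini_G/=.
  have := @ge0_integral_affine 1 (a * y) (fun x => f (x, y)) ltr01.
  rewrite invr1 mul1e => <-//; last exact: measurableT_comp.
  by apply: eq_integral => x _; rewrite mul1r.
Qed.

(* A plane rotation is the product of three shears. *)
Lemma ge0_integral_rotation (c s : R) (f : R * R -> \bar R) :
  (c ^+ 2 + s ^+ 2 = 1)%R -> s != 0%R ->
  measurable_fun setT f -> (forall p, 0 <= f p) ->
  \int[mu \x mu]_p f (c * p.1 + s * p.2, c * p.2 - s * p.1)%R =
  \int[mu \x mu]_p f p.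
Proof.
move=> cs s0 mf f0.
(* For [c] the cosine and [s] the sine of an angle, [t] is the tangent of its half. The shears are
   horizontal by [t], vertical by [- s], horizontal by [t]. *)
pose t : R := ((1 - c) / s)%R.
have mh a : measurable_fun setT
    (fun p : R * R => (p.1 + a * p.2, p.2)%R : measurableTypeR R * measurableTypeR R).
  apply: measurable_fun_pair => //.
  by apply: measurable_funD => //; exact: measurable_funM.
have mv a : measurable_fun setT
    (fun p : R * R => (p.1, p.2 + a * p.1)%R : measurableTypeR R * measurableTypeR R).
  apply: measurable_fun_pair => //.
  by apply: measurable_funD => //; exact: measurable_funM.
rewrite -(ge0_integral_shear t mf f0).2.
have mf1 := measurableT_comp mf (mh t).
rewrite -(ge0_integral_shear (- s) mf1 _).1; last by move=> p; exact: f0.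
have mf2 := measurableT_comp mf1 (mv (- s)%R).
rewrite -(ge0_integral_shear t mf2 _).2; last by move=> p; exact: f0.
have cE : (c = 1 - t * s)%R by rewrite /t; field.
have sE : (s = t * (1 - t * s) + t)%R.
  have s2 : (s ^+ 2 = 1 - c ^+ 2)%R by rewrite -cs; ring.
  rewrite -cE /t; transitivity (s ^+ 2 / s)%R; first by field.
  by rewrite s2; field.
apply: eq_integral => -[x y] _ /=; congr (f (_, _)); last by rewrite cE; ring.
by rewrite [in (s * y)%R]sE [in (c * x)%R]cE; ring.
Qed.

End lebesgue_affine.

(** * Rotation invariance of the standard Gaussian law of the plane *)

Section planar_gaussian.
Context {R : realType}.
Local Notation mu := (@lebesgue_measure R).
Local Notation gamma := (@normal_prob R 0 1).
Local Open Scope ereal_scope.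

Definition normal_pdf2 (p : R * R) : \bar R :=
  (normal_pdf 0 1 p.1 * normal_pdf 0 1 p.2)%:E.

(** Given by a density rather than as a product measure, so that the rotation formula for Lebesgue
    integrals applies directly. *)
Definition normal_prob2 (D : set (measurableTypeR R * measurableTypeR R)) :=
  \int[mu \x mu]_(p in D) normal_pdf2 p.

Lemma normal_pdf2_ge0 p : 0 <= normal_pdf2 p.
Proof. by rewrite lee_fin mulr_ge0// normal_pdf_ge0. Qed.

Lemma measurable_normal_pdf2 : measurable_fun setT normal_pdf2.
Proof.
apply/measurable_EFinP; apply: measurable_funM.
  exact: (measurableT_comp (measurable_normal_pdf 0%R 1%R)).
exact: (measurableT_comp (measurable_normal_pdf 0%R 1%R)).
Qed.

Let normal_prob2_0 : normal_prob2 set0 = 0.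
Proof. by rewrite /normal_prob2 integral_set0. Qed.

Let normal_prob2_ge0 D : 0 <= normal_prob2 D.
Proof. by apply: integral_ge0 => p _; exact: normal_pdf2_ge0. Qed.

Let normal_prob2_sigma_additive : semi_sigma_additive normal_prob2.
Proof.
move=> F mF tF mUF; rewrite /normal_prob2 ge0_integral_bigcup//.
- by apply: is_cvg_ereal_nneg_natsum_cond => n _ _; exact: normal_prob2_ge0.
- exact: measurable_funTS measurable_normal_pdf2.
- by move=> p _; exact: normal_pdf2_ge0.
Qed.

HB.instance Definition _ := isMeasure.Build _ _ _ normal_prob2
  normal_prob2_0 normal_prob2_ge0 normal_prob2_sigma_additive.

(** The density times the indicator of a rectangle splits into a function of each coordinate, and
    Tonelli factors the integral. *)
Lemma normal_prob2_rectangle (A B : set R) : measurable A -> measurable B ->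
  normal_prob2 (A `*` B) = gamma A * gamma B.
Proof.
move=> mA mB.
pose f (C : set R) x : \bar R := ((fun x => (normal_pdf 0 1 x)%:E) \_ C) x.
have f0 C x : 0 <= f C x.
  by rewrite /f patchE; case: ifP => // _; rewrite lee_fin normal_pdf_ge0.
have mf C : measurable C -> measurable_fun setT (f C).
  move=> mC; apply/(measurable_restrictT _ mC).
  by apply/measurable_EFinP/measurable_funTS; exact: measurable_normal_pdf.
rewrite /normal_prob2 integral_mkcond.
transitivity (\int[mu \x mu]_p (f A p.1 * f B p.2)).
  apply: eq_integral => -[x y] _; rewrite /f !patchE in_setX/=.
  by do 2 case: (_ \in _); rewrite ?mule0 ?mul0e.
have mff : measurable_fun [set: measurableTypeR R * measurableTypeR R]
    (fun p => f A p.1 * f B p.2).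
  by apply: emeasurable_funM; [exact: measurableT_comp (mf A mA) _|
                             exact: measurableT_comp (mf B mB) _].
rewrite fubini_tonelli1//; last by move=> p; rewrite mule_ge0.
rewrite /fubini_F/=.
transitivity (\int[mu]_x (f A x * \int[mu]_y f B y)).
  by apply: eq_integral => x _; rewrite ge0_integralZl//; exact: mf.
rewrite ge0_integralZr//; [|exact: mf|exact: integral_ge0].
by congr *%E; rewrite /normal_prob [RHS]integral_mkcond.
Qed.

(** The density depends only on the squared norm, which a rotation preserves, and so does the plane
    Lebesgue integral. *)
Lemma normal_prob2_rotation (c s : R) (A B : set R) :
  (c ^+ 2 + s ^+ 2 = 1)%R -> s != 0%R -> measurable A -> measurable B ->
  normal_prob2
    [set p | A (c * p.1 + s * p.2)%R /\ B (c * p.2 - s * p.1)%R] =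
  gamma A * gamma B.
Proof.
move=> cs s0 mA mB; rewrite -normal_prob2_rectangle//.
rewrite /normal_prob2 [LHS]integral_mkcond [RHS]integral_mkcond.
have mAB : measurable (A `*` B) by exact: measurableX.
rewrite -[RHS](ge0_integral_rotation cs s0); last 2 first.
- apply/(measurable_restrictT _ mAB).
  exact: measurable_funTS measurable_normal_pdf2.
- by move=> p; rewrite patchE; case: ifP => // _; exact: normal_pdf2_ge0.
apply: eq_integral => p _; rewrite !patchE.
set b := (X in if X then _ else _); set b' := (X in _ = if X then _ else _).
have -> : b = b' by apply/idP/idP => /set_mem ?; exact/mem_set.
case: ifP => // _; rewrite /normal_pdf2 !normal_pdfE ?oner_neq0//=.
congr EFin; rewrite mulrACA [RHS]mulrACA; congr *%R.
rewrite /normal_fun -!expRD; congr expR; rewrite !subr0.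
rewrite -!mulrDl; congr (_ / _)%R; rewrite -!opprD; congr (- _)%R.
rewrite -[LHS]mul1r -cs; ring.
Qed.

(** The event [E] is meant to carry the constraints on all other coordinates. On [E] the pair has
    the planar Gaussian law scaled by [P E], and that law is rotation invariant. *)
Lemma rotation_normal_pair d (Omega : measurableType d)
    (P : probability Omega R) (X Y : Omega -> R) (E : set Omega) (c s : R) :
  (c ^+ 2 + s ^+ 2 = 1)%R -> s != 0%R ->
  measurable_fun setT X -> measurable_fun setT Y -> measurable E ->
  (forall A B, measurable A -> measurable B ->
    P (X @^-1` A `&` Y @^-1` B `&` E) = gamma A * gamma B * P E) ->
  forall A B, measurable A -> measurable B ->
    P ((fun w => c * X w + s * Y w)%R @^-1` A `&`
       (fun w => c * Y w - s * X w)%R @^-1` B `&` E) = gamma A * gamma B * P E.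
Proof.
move=> cs s0 mX mY mE XYE A B mA mB.
pose XY w : measurableTypeR R * measurableTypeR R := (X w, Y w).
have mXY : measurable_fun setT XY by exact: measurable_fun_pair.
pose K : {nonneg R} := NngNum (fine_ge0 (measure_ge0 P E)).
have KE : K%:num%:E = P E by rewrite /= fineK// fin_num_measure.
pose D : set (measurableTypeR R * measurableTypeR R) :=
  [set p | A (c * p.1 + s * p.2)%R /\ B (c * p.2 - s * p.1)%R].
have mD : measurable D.
  rewrite (_ : D = (fun p => (c * p.1 + s * p.2)%R) @^-1` A `&`
                   (fun p => (c * p.2 - s * p.1)%R) @^-1` B)//.
  apply: measurableI; apply: measurable_preimage => //.
    by apply: measurable_funD; exact: measurable_funM.
  by apply: measurable_funB; exact: measurable_funM.
transitivity (pushforward (mrestr P mE) XY D); first by [].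
rewrite (@eq_measure_rectangles _ _ _ _ _ (pushforward (mrestr P mE) XY)
  (mscale K normal_prob2))//.
- transitivity (K%:num%:E * (gamma A * gamma B)); last by rewrite KE muleC.
  by congr *%E; exact: normal_prob2_rotation.
- rewrite [ltLHS](_ : _ = P (XY @^-1` setT `&` E))//.
  by rewrite preimage_setT setTI ltey_eq fin_num_measure.
- move=> A' B' mA' mB'; rewrite /mscale.
  transitivity (P (X @^-1` A' `&` Y @^-1` B' `&` E)); first by [].
  by rewrite XYE// [LHS]muleC -KE -normal_prob2_rectangle.
Qed.

End planar_gaussian.

(** * Families of independent standard normal variables and their rotations *)

Section iid_normal.
Context {d : measure_display} {Omega : measurableType d} {R : realType}
  (P : probability Omega R) {I : finType}.
Local Notation gamma := (@normal_prob R 0 1).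
Implicit Types (g : I -> Omega -> R) (u v c : I -> R) (i j : I).

(** The index is any finite type, so that a disjoint union can index two merged families. *)
Definition iid_normal g : Prop :=
  (forall i, measurable_fun setT (g i)) /\
  forall B : I -> set R, (forall i, measurable (B i)) ->
    P (\bigcap_i (g i @^-1` B i)) = (\prod_i gamma (B i))%E.

Definition plane_rotation i j (c s : R) u : I -> R := fun l =>
  if l == i then c * u i + s * u j else
  if l == j then c * u j - s * u i else u l.

(** The cross terms cancel. Hence rotating coefficients and variables together changes no linear
    combination, and rotating two coefficient vectors keeps them orthogonal. *)
Lemma plane_rotation_dot i j (c s : R) u v : c ^+ 2 + s ^+ 2 = 1 -> i != j ->
  \sum_l plane_rotation i j c s u l * plane_rotation i j c s v l =
  \sum_l u l * v l.
Proof.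
move=> cs ij; have ji : j != i by rewrite eq_sym.
rewrite (bigD1 i)//= (bigD1 j)//= [RHS](bigD1 i)//= [in RHS](bigD1 j)//=.
rewrite !addrA; congr (_ + _); last first.
  by apply: eq_bigr => l /andP[/negPf li /negPf lj]; rewrite /plane_rotation li lj.
rewrite /plane_rotation !eqxx (negPf ji).
transitivity ((c ^+ 2 + s ^+ 2) * (u i * v i + u j * v j)); first by ring.
by rewrite cs mul1r.
Qed.

Lemma bigcap_pair (F : I -> set Omega) i j :
  \bigcap_l F l = F i `&` F j `&` \bigcap_(l in [set l | l != i /\ l != j]) F l.
Proof.
apply/seteqP; split => w.
  by move=> Fw; split=> [|l _]; [split|]; exact: Fw.
move=> [[Fi Fj] Fw] l _.
have [->//|li] := eqVneq l i; have [->//|lj] := eqVneq l j.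
exact: Fw.
Qed.

Lemma iid_normal_rotation g i j (c s : R) :
  c ^+ 2 + s ^+ 2 = 1 -> s != 0 -> i != j -> iid_normal g ->
  iid_normal (fun l w => plane_rotation i j c s (g^~ w) l).
Proof.
move=> cs s0 ij [mg gE]; have ji : j != i by rewrite eq_sym.
split.
  move=> l; rewrite /plane_rotation; case: (l == i).
    by apply: measurable_funD; apply: measurable_funM.
  case: (l == j) => //.
  by apply: measurable_funB; apply: measurable_funM.
move=> B mB.
pose D := [set l | l != i /\ l != j].
(* [E] gathers the constraints on the coordinates that the rotation fixes; it is independent of the
   pair at [i] and [j]. *)
pose E := \bigcap_(l in D) (g l @^-1` B l).
have mE : measurable E.
  apply: fin_bigcap_measurable => [|l _].
    exact: finite_finset.
  exact: measurable_preimage.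
have prodE (f : I -> \bar R) :
    (\prod_l f l = f i * f j * \prod_(l | (l != i) && (l != j)) f l)%E.
  by rewrite (bigD1 i)//= (bigD1 j)//= muleA.
have gE' A A' : measurable A -> measurable A' ->
    P (g i @^-1` A `&` g j @^-1` A' `&` E) =
    (gamma A * gamma A' * \prod_(l | (l != i) && (l != j)) gamma (B l))%E.
  move=> mA mA'.
  pose B' l := if l == i then A else if l == j then A' else B l.
  have mB' l : measurable (B' l) by rewrite /B'; do 2 case: ifP => //.
  have := gE B' mB'; rewrite (bigcap_pair _ i j) prodE.
  have -> : \bigcap_(l in D) (g l @^-1` B' l) = E.
    by apply: eq_bigcapr => l [/negPf li /negPf lj]; rewrite /B' li lj.
  have -> : B' i = A by rewrite /B' eqxx.
  have -> : B' j = A' by rewrite /B' eqxx (negPf ji).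
  move=> ->; congr *%E.
  by apply: eq_bigr => l /andP[/negPf li /negPf lj]; rewrite /B' li lj.
have PE : P E = (\prod_(l | (l != i) && (l != j)) gamma (B l))%E.
  have := gE' _ _ measurableT measurableT.
  by rewrite !preimage_setT !setTI probability_setT !mul1e.
rewrite (bigcap_pair _ i j) prodE -PE.
rewrite -(@rotation_normal_pair _ _ _ P (g i) (g j) E c s)//; last first.
  by move=> A A' mA mA'; rewrite gE'// PE.
congr (P _); rewrite /plane_rotation eqxx (negPf ji) eqxx; congr (_ `&` _).
by apply: eq_bigcapr => l [/negPf li /negPf lj]; rewrite li lj.
Qed.

(** The density is even and Lebesgue measure is invariant under negation. *)
Lemma normal_prob_opp (A : set R) : measurable A ->
  gamma (-%R @^-1` A) = gamma A.
Proof.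
move=> mA; rewrite /normal_prob [RHS]integral_mkcond.
pose f x := ((fun x => (normal_pdf 0 1 x)%:E) \_ A) x.
transitivity (\int[pushforward (@lebesgue_measure R)
    (-%R : _ -> measurableTypeR R)]_x f x)%E; last first.
  apply: eq_measure_integral => B mB _; exact: lebesgue_measureN.
rewrite ge0_integral_pushforward//; last 2 first.
- apply/(measurable_restrictT _ mA).
  by apply/measurable_EFinP/measurable_funTS; exact: measurable_normal_pdf.
- by move=> x _; rewrite /f patchE; case: ifP => // _; rewrite lee_fin normal_pdf_ge0.
rewrite preimage_setT [LHS]integral_mkcond; apply: eq_integral => x _.
rewrite /f /= !patchE; set b := (X in if X then _ else _).
set b' := (X in _ = if X then _ else _).
have -> : b = b' by apply/idP/idP => /set_mem ?; exact/mem_set.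
by rewrite !normal_pdfE ?oner_neq0//= /normal_fun !subr0 sqrrN.
Qed.

(** The combinations with coefficients [B k] avoid coordinate [i], so they are independent of [g i],
    whose law is symmetric. *)
Lemma half_line_coord g i (t : R) (K : finType) (B : K -> I -> R)
    (C : K -> set R) :
  iid_normal g -> (forall k, B k i = 0) -> (forall k, measurable (C k)) ->
  P ([set w | t * g i w <= 0] `&`
     \bigcap_k ((fun w => \sum_l B k l * g l w) @^-1` C k)) =
  P ([set w | 0 <= t * g i w] `&`
     \bigcap_k ((fun w => \sum_l B k l * g l w) @^-1` C k)).
Proof.
move=> [mg gE] Bi0 mC.
pose H1 : set R := [set x | t * x <= 0].
pose H2 : set R := [set x | 0 <= t * x].
have mt : measurable_fun setT (fun x : R => t * x) by exact: measurable_funM.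
have mH1 : measurable H1.
  by rewrite /H1 -preimage_itvNyc; exact: measurable_preimage.
have mH2 : measurable H2.
  by rewrite /H2 -preimage_itvcy; exact: measurable_preimage.
have H12 : gamma H1 = gamma H2.
  rewrite -normal_prob_opp//; congr gamma; apply/seteqP.
  by split => x; rewrite /H1 /H2 /= mulrN oppr_le0.
have mF1 : measurable (g i @^-1` H1) by exact: measurable_preimage.
have mF2 : measurable (g i @^-1` H2) by exact: measurable_preimage.
(* Coordinate [i] is replaced by a constant: the index type stays the same, while the family
   generates only the sigma-algebra of the other coordinates. *)
pose X l := if l == i then cst 0 else g l.
have mX l : measurable_fun setT (X l) by rewrite /X; case: ifP.
set A := \bigcap_k _.
(* The constraint on the constant coordinate is either vacuous or impossible, according to whether
   [A' i] contains 0. *)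
have boxE (A' : I -> set R) H : measurable H -> (forall l, measurable (A' l)) ->
    P (\bigcap_l (X l @^-1` A' l) `&` g i @^-1` H) =
    (if 0%R \in A' i then gamma H * \prod_(l | l != i) gamma (A' l) else 0)%E.
  move=> mH mA'; case: ifPn => [/set_mem A0|A0]; last first.
    rewrite [X in P X](_ : _ = set0) ?measure0// -subset0 => w [] /(_ i Logic.I).
    by rewrite /X eqxx/= => /mem_set; rewrite (negPf A0).
  pose A'' l := if l == i then H else A' l.
  have mA'' l : measurable (A'' l) by rewrite /A''; case: ifP.
  have := gE A'' mA''; rewrite (bigD1 i)//= {2}/A'' eqxx.
  rewrite (eq_bigr (fun l => gamma (A' l))); last first.
    by move=> l /negPf li; rewrite /A'' li.
  move=> <-; congr (P _); apply/seteqP; split => w.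
    move=> [Xw Hw] l _; rewrite /A''; case: eqVneq => [->//|/negPf li].
    by have := Xw l Logic.I; rewrite /X li.
  move=> gw; split; last by have := gw i Logic.I; rewrite /A'' eqxx.
  move=> l _; have := gw l Logic.I; rewrite /A'' /X; case: eqVneq => //= ->.
  by [].
rewrite setIC [in RHS]setIC.
apply: (@eq_measure_boxes _ _ _ _ X (mrestr P mF1) (mrestr P mF2)) => //.
- rewrite [ltLHS](_ : _ = P (setT `&` g i @^-1` H1))// setTI.
  by rewrite ltey_eq fin_num_measure.
- move=> A' mA'.
  transitivity (P (\bigcap_l (X l @^-1` A' l) `&` g i @^-1` H1)); first by [].
  by rewrite boxE// H12 -boxE.
- pose OX := g_sigma_algebraType
    (\bigcup_l preimage_set_system [set: Omega] (X l) measurable).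
  suff : @measurable _ OX A by [].
  apply: fin_bigcap_measurable => // k _.
  apply: measurable_preimage => //.
  rewrite (_ : (fun w => _) = (fun w => \sum_l B k l * X l w)); last first.
    apply/funext => w; apply: eq_bigr => l _; rewrite /X.
    by case: eqVneq => // ->; rewrite Bi0 !mul0r.
  apply: measurable_sum => l; apply: measurable_funM => //.
  move=> _ Y mY; apply: sub_sigma_algebra; exists l => //.
  by exists Y.
Qed.

End iid_normal.

(* Plane rotations reduce [c] to a multiple of a coordinate vector without
   changing its orthogonality to the rows of [B]; the linear combinations
   [\sum_l B k l * g l] then do not involve that coordinate. *)
Lemma half_line_orthogonal d (Omega : measurableType d) (R : realType)
    (P : probability Omega R) (I K : finType) (g : I -> Omega -> R)
    (c : I -> R) (B : K -> I -> R) (C : K -> set R) :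
  iid_normal P g -> (forall k, \sum_l B k l * c l = 0) ->
  (forall k, measurable (C k)) ->
  P ([set w | \sum_l c l * g l w <= 0] `&`
     \bigcap_k ((fun w => \sum_l B k l * g l w) @^-1` C k)) =
  P ([set w | 0 <= \sum_l c l * g l w] `&`
     \bigcap_k ((fun w => \sum_l B k l * g l w) @^-1` C k)).
Proof.
(* Induction on the number of nonzero coefficients of [c], with [g], [c] and [B] all varying since
   the rotation acts on each of them. *)
have [n] := ubnP #|[pred l | c l != 0]|.
elim: n g c B => // n IHn g c B; rewrite ltnS => cn iidg Bc mC.
have [i ci|c0] := pickP [pred l | c l != 0]; last first.
  have cg0 w : \sum_l c l * g l w = 0.
    by apply: big1 => l _; have := c0 l => /= /negbFE/eqP ->; rewrite mul0r.
  congr (P (_ `&` _)); apply/seteqP.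
  by split => w _ /=; rewrite cg0.
have [j /andP[/= ji cj]|cj0] := pickP [pred l | (l != i) && (c l != 0)]; last first.
  (* Only [c i] is nonzero here, so orthogonality reads [B k i * c i = 0] and yields [B k i = 0]. *)
  have cl0 l : l != i -> c l = 0.
    by move=> li; have := cj0 l; rewrite /= li => /negbFE/eqP.
  have cgE w : \sum_l c l * g l w = c i * g i w.
    by rewrite (bigD1 i)//= big1 ?addr0// => l /cl0 ->; rewrite mul0r.
  under [X in P (X `&` _)]eq_set do rewrite cgE.
  under [X in _ = P (X `&` _)]eq_set do rewrite cgE.
  apply: half_line_coord => // k.
  have := Bc k; rewrite (bigD1 i)//= big1 ?addr0; last first.
    by move=> l /cl0 ->; rewrite mulr0.
  by move/eqP; rewrite mulf_eq0 (negPf ci) orbF => /eqP.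
have ij : i != j by rewrite eq_sym.
(* The rotation with cosine [c i / r] and sine [c j / r] sends the pair [(c i, c j)] to [(r, 0)]. *)
pose r := Num.sqrt (c i ^+ 2 + c j ^+ 2).
have r2_gt0 : 0 < c i ^+ 2 + c j ^+ 2.
  by rewrite ltr_wpDl ?sqr_ge0// exprn_even_gt0.
have r2 : r ^+ 2 = c i ^+ 2 + c j ^+ 2 by rewrite sqr_sqrtr// ltW.
have r0 : r != 0 by rewrite gt_eqF// sqrtr_gt0.
have cs : (c i / r) ^+ 2 + (c j / r) ^+ 2 = 1.
  by rewrite !expr_div_n -mulrDl -r2 divff// expf_neq0.
have s0 : c j / r != 0 by rewrite mulf_neq0// invr_neq0.
pose rot := plane_rotation i j (c i / r) (c j / r).
have rotE u w : \sum_l u l * g l w = \sum_l rot u l * rot (g^~ w) l.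
  by rewrite plane_rotation_dot.
have bigcapE : \bigcap_k ((fun w => \sum_l B k l * g l w) @^-1` C k) =
    \bigcap_k ((fun w => \sum_l rot (B k) l * rot (g^~ w) l) @^-1` C k).
  by apply: eq_bigcapr => k _; apply/seteqP; split => w /=; rewrite rotE.
under [X in P (X `&` _)]eq_set do rewrite rotE.
under [X in _ = P (X `&` _)]eq_set do rewrite rotE.
rewrite bigcapE.
apply: (IHn (fun l w => rot (g^~ w) l) (rot c) (fun k => rot (B k))) => //.
(* The support of [c] loses [j] and gains nothing, as [i] already belonged to it. *)
- apply: leq_trans cn; apply: proper_card; apply/properP; split.
    apply/fintype.subsetP => l; rewrite !inE /rot /plane_rotation.
    by have [->|_] := eqVneq l i; last have [->|_] := eqVneq l j.
  exists j; first by rewrite inE.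
  by rewrite !inE negbK /rot /plane_rotation (negPf ji) eqxx; apply/eqP; field.
- exact: iid_normal_rotation.
- by move=> k; rewrite plane_rotation_dot.
Qed.

(** * Transfer to a product space, scaling of normal laws, invertibility of the noisy Gram matrix *)

(** The normal variables representing [h] live on another space than the noise. The product of the
    two spaces carries both, independently, and reproduces the joint law; rectangles suffice to
    check it. *)
Lemma eq_law_product d1 d2 d3 d4 (R : realType) (Omega : measurableType d1)
    (Omega' : measurableType d2) (T1 : measurableType d3)
    (T2 : measurableType d4) (P : probability Omega R)
    (P' : probability Omega' R) (X : Omega -> T1) (Y : Omega -> T2)
    (X' : Omega' -> T1) :
  measurable_fun setT X -> measurable_fun setT Y -> measurable_fun setT X' ->
  (forall A, measurable A -> P (X @^-1` A) = P' (X' @^-1` A)) ->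
  (forall A B, measurable A -> measurable B ->
    P (X @^-1` A `&` Y @^-1` B) = P (X @^-1` A) * P (Y @^-1` B))%E ->
  forall D : set (T1 * T2), measurable D ->
    P [set w | D (X w, Y w)] = (P' \x P)%E [set w | D (X' w.1, Y w.2)].
Proof.
move=> mX mY mX' XX' XY D mD.
pose f w := (X w, Y w); pose f' (w : Omega' * Omega) := (X' w.1, Y w.2).
have mf : measurable_fun setT f by exact: measurable_fun_pair.
have mf' : measurable_fun setT f'.
  by apply: measurable_fun_pair; exact: measurableT_comp.
apply: (@eq_measure_rectangles _ _ _ _ _ (pushforward P f)
  (pushforward (P' \x P)%E f')) => //.
- by rewrite [ltLHS](_ : _ = P setT)// probability_setT ltry.
- move=> A B mA mB.
  transitivity (P (X @^-1` A `&` Y @^-1` B)); first by [].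
  rewrite XY// XX'//.
  by rewrite -product_measure1E//; exact: measurable_preimage.
Qed.

(** The density involves [s] only through its square and the test [s == 0]. This covers a negative
    standard deviation parameter. *)
Lemma normal_prob_normr (R : realType) (s : R) (A : set R) :
  normal_prob 0 `|s| A = normal_prob 0 s A.
Proof.
rewrite /normal_prob; apply: eq_integral => x _.
by rewrite /normal_pdf normr_eq0 /normal_peak /normal_fun real_normK// num_real.
Qed.

Lemma normal_prob_scale (R : realType) (s : R) (A : set R) : s != 0 ->
  measurable A ->
  normal_prob 0 s ((fun x => x / `|s|) @^-1` A) = normal_prob 0 1 A.
Proof.
move=> s_neq0 mA; rewrite -normal_prob_normr.
have s0 : 0 < `|s| by rewrite normr_gt0.
move: `|s| s0 => {s_neq0}s s0; rewrite /normal_prob [RHS]integral_mkcond.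
pose f x := ((fun x => (normal_pdf 0 1 x)%:E) \_ A) x.
have mf : measurable_fun setT f.
  apply/(measurable_restrictT _ mA).
  by apply/measurable_EFinP/measurable_funTS; exact: measurable_normal_pdf.
have f0 x : (0 <= f x)%E.
  by rewrite /f patchE; case: ifP => // _; rewrite lee_fin normal_pdf_ge0.
have si0 : 0 < s^-1 by rewrite invr_gt0.
transitivity (s^-1%:E * \int[lebesgue_measure]_x f (s^-1 * x + 0)%R)%E; last first.
  rewrite ge0_integral_affine// invrK muleA -EFinM mulVf ?gt_eqF//.
  by rewrite mul1e.
rewrite -ge0_integralZl//; last 2 first.
- exact: (measurableT_comp mf (measurable_affine s^-1 0)).
- by rewrite lee_fin ltW.
rewrite [LHS]integral_mkcond; apply: eq_integral => x _.
rewrite /f !patchE addr0 mulrC.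
set b := (X in if X then _ else _); set b' := (X in _ = (_ * if X then _ else _)%E).
have -> : b = b' by apply/idP/idP => /set_mem ?; exact/mem_set.
case: ifP => _; last by rewrite mule0.
rewrite -EFinM !normal_pdfE ?gt_eqF ?oner_neq0//; congr EFin.
rewrite mulrA; congr (_ * _).
  rewrite /normal_peak expr1n mul1r -mulrnAr sqrtrM ?sqr_ge0// sqrtr_sqr.
  by rewrite gtr0_norm// invfM.
rewrite /normal_fun !subr0 expr1n; congr expR.
by field; rewrite gt_eqF.
Qed.

(** If [u] is in the left kernel, its quadratic form is a nonnegative term plus [s2] times its
    squared norm; both vanish, so [u] is 0. *)
Lemma gram_mx_noise_unit (R : realType) (T : Type) (k : T -> T -> R) (s2 : R)
    n (x : 'I_n -> T) : psd_kernel k -> 0 < s2 ->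
  gram_mx k x + s2%:M \in unitmx.
Proof.
move=> [_ k_psd] s2_gt0; rewrite -row_free_unit; apply: inj_row_free => u uM.
have : (u *m (gram_mx k x + s2%:M) *m u^T) 0 0 = 0 by rewrite uM mul0mx mxE.
rewrite mulmxDr mulmxDl mxE mul_mx_scalar -scalemxAl => uMu.
have uKu : 0 <= (u *m gram_mx k x *m u^T) 0 0.
  rewrite mxE; under eq_bigr => j _ do rewrite !mxE mulr_suml.
  rewrite exchange_big/=; have := k_psd n x (fun i => u 0 i).
  congr (0 <= _); apply: eq_bigr => i _; apply: eq_bigr => j _.
  by rewrite !mxE mulrAC.
have uu0 : \sum_i u 0 i ^+ 2 = 0.
  have uu : (s2 *: (u *m u^T)) 0 0 = s2 * \sum_i u 0 i ^+ 2.
    by rewrite !mxE; congr (_ * _); apply: eq_bigr => i _; rewrite mxE expr2.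
  move: uMu => /eqP; rewrite uu paddr_eq0//; last first.
    by apply: mulr_ge0; [exact: ltW|apply: sumr_ge0 => i _; exact: sqr_ge0].
  by move=> /andP[_]; rewrite mulf_eq0 gt_eqF//= => /eqP.
apply/rowP => i; rewrite mxE; apply/eqP; rewrite -sqrf_eq0; apply/eqP.
by move: uu0 => /psumr_eq0P -> // j _; exact: sqr_ge0.
Qed.

(** * Symmetry of the posterior residual given the observations *)

Section residual.
Context {R : realType} {T : Type} (k : T -> T -> R) (k_psd : psd_kernel k).
Context {m : nat} (bs : 'I_m -> T).
Context {d : measure_display} {Omega : measurableType d}
  (P : probability Omega R).
Context (h : T -> {RV P >-> R}) (h_gp : centered_gaussian_process h k).
Context (sigma : R) (sigma2_gt0 : 0 < sigma ^+ 2).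
Context (eps : 'I_m -> {RV P >-> R})
  (eps_normal : forall i, normal_rv (eps i) 0 sigma)
  (eps_indep : mutually_independent eps)
  (eps_indep_h : independent_families h eps).
Context (v : 'I_m -> {RV P >-> R})
  (v_obs : forall i w, v i w = h (bs i) w + eps i w) (b : T).

Definition residual (w : Omega) : R :=
  h b w - post_mean k (sigma ^+ 2) bs (\col_i v i w) b.

Definition post_weight : 'rV[R]_m :=
  (kernel_vec k bs b)^T *m invmx (gram_mx k bs + (sigma ^+ 2)%:M).

Lemma residualE w : residual w = h b w - \sum_i post_weight 0 i * v i w.
Proof.
rewrite /residual /post_mean mxE; congr (_ - _).
by apply: eq_bigr => i _; congr (_ * _); exact: mxE.
Qed.

Lemma measurable_residual : measurable_fun setT residual.
Proof.
rewrite (_ : residual = fun w => h b w - \sum_i post_weight 0 i * v i w).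
  apply: measurable_funB => //; apply: measurable_sum => i.
  exact: measurable_funM.
by apply/funext => w; rewrite residualE.
Qed.

(** The normal equations of the regression, obtained by multiplying [post_weight] back by the
    inverted matrix; they express that the residual is uncorrelated with each observation. *)
Lemma post_weightE i :
  \sum_j post_weight 0 j * k (bs j) (bs i) + post_weight 0 i * sigma ^+ 2 =
  k (bs i) b.
Proof.
have := mulmxKV (gram_mx_noise_unit bs k_psd sigma2_gt0) (kernel_vec k bs b)^T.
rewrite -/post_weight mulmxDr mul_mx_scalar => /rowP/(_ i).
rewrite !mxE [sigma ^+ 2 * _]mulrC => <-; congr (_ + _).
by apply: eq_bigr => j _; rewrite !mxE.
Qed.

(** The queried point gets index [ord0] and the observation points follow, so that a single Gaussian
    vector covers [h] at all of them. *)
Let x (l : 'I_m.+1) : T := oapp bs b (unlift ord0 l).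

Let x0 : x ord0 = b. Proof. by rewrite /x unlift_none. Qed.

Let xS i : x (lift ord0 i) = bs i. Proof. by rewrite /x liftK. Qed.

(** [obs] and [res] recompute observations and residual from the values of [h] and the noises, so
    that events can be moved to the product space. *)
Let obs (p : m.+1.-tuple R * m.-tuple R) i : R :=
  tnth p.1 (lift ord0 i) + tnth p.2 i.

Let res (p : m.+1.-tuple R * m.-tuple R) : R :=
  tnth p.1 ord0 - \sum_i post_weight 0 i * obs p i.

Let measurable_obs i : measurable_fun setT (obs^~ i).
Proof.
apply: measurable_funD.
  by apply: (measurableT_comp (measurable_tnth (lift ord0 i))).
by apply: (measurableT_comp (measurable_tnth i)).
Qed.

Let measurable_res : measurable_fun setT res.
Proof.
apply: measurable_funB.
  by apply: (measurableT_comp (measurable_tnth ord0)).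
by apply: measurable_sum => i; exact: measurable_funM.
Qed.

Let X w := [tuple h (x l) w | l < m.+1].
Let Y w := [tuple eps i w | i < m].

Let measurable_sigma_of (J : Type) (F : J -> {RV P >-> R}) n (y : 'I_n -> J)
    (A : set (n.-tuple R)) :
  measurable A -> sigma_of F ((fun w => [tuple F (y i) w | i < n]) @^-1` A).
Proof.
move=> mA.
pose OF := g_sigma_algebraType
  (\bigcup_i preimage_set_system [set: Omega] (F i) measurable).
suff : measurable_fun [set: OF] (fun w => [tuple F (y i) w | i < n]).
  by move=> mf; apply: (@measurable_preimage _ _ OF) => //; exact: measurableT.
apply/measurable_fun_tnthP => i.
rewrite (_ : _ \o _ = F (y i)); last by apply/funext => w; rewrite /= tnth_mktuple.
move=> _ B mB; apply: sub_sigma_algebra; exists (y i) => //.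
by exists B.
Qed.

Let measurable_tuple_rv d' (Omega' : measurableType d') n
    (F : 'I_n -> Omega' -> R) :
  (forall i, measurable_fun setT (F i)) ->
  measurable_fun setT (fun w => [tuple F i w | i < n]).
Proof.
move=> mF; apply/measurable_fun_tnthP => i.
by rewrite (_ : _ \o _ = F i)//; apply/funext => w; rewrite /= tnth_mktuple.
Qed.

(** On the product space, residual and observations are linear in one family of independent standard
    normals, with orthogonal coefficients; [half_line_orthogonal] then applies. *)
Lemma residual_symmetric (C : 'I_m -> set R) : (forall i, measurable (C i)) ->
  P ([set w | residual w <= 0] `&` \bigcap_i (v i @^-1` C i)) =
  P ([set w | 0 <= residual w] `&` \bigcap_i (v i @^-1` C i)).
Proof.
move=> mC.
have [d' [Om' [P' [r [xi [A [AAT xi_indep xi_normal hA]]]]]]] := h_gp x.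
pose F l (w : Om') : R := (0 : 'cV[R]_m.+1) l 0 + \sum_j A l j * xi j w.
pose X' w := [tuple F l w | l < m.+1].
have mX : measurable_fun setT X by exact: measurable_tuple_rv.
have mY : measurable_fun setT Y by exact: measurable_tuple_rv.
have mX' : measurable_fun setT X'.
  apply: measurable_tuple_rv => l; apply: measurable_funD => //.
  by apply: measurable_sum => j; exact: measurable_funM.
have XY D1 D2 : measurable D1 -> measurable D2 ->
    (P (X @^-1` D1 `&` Y @^-1` D2) = P (X @^-1` D1) * P (Y @^-1` D2))%E.
  move=> mD1 mD2; apply: eps_indep_h.
    exact: (@measurable_sigma_of _ h _ x).
  exact: (@measurable_sigma_of _ eps _ id).
have law := eq_law_product mX mY mX' hA XY.
pose box (S : set R) := [set p | S (res p) /\ forall i, C i (obs p i)].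
have mbox S : measurable S -> measurable (box S).
  move=> mS; rewrite (_ : box S = res @^-1` S `&` \bigcap_i ((obs^~ i) @^-1` C i)).
    apply: measurableI; first exact: measurable_preimage.
    apply: fin_bigcap_measurable => // i _; exact: measurable_preimage.
  apply/seteqP; split => p [? Cp]; split => // i; first by move=> _; exact: Cp.
  exact: (Cp i Logic.I).
have obsE w i : obs (X w, Y w) i = v i w.
  by rewrite /obs !tnth_mktuple xS v_obs.
have resE w : res (X w, Y w) = residual w.
  rewrite /res residualE tnth_mktuple x0; congr (_ - _).
  by apply: eq_bigr => i _; rewrite obsE.
have boxE S : P ([set w | S (residual w)] `&` \bigcap_i (v i @^-1` C i)) =
    P [set w | box S (X w, Y w)].
  congr (P _); apply/seteqP; split => w; rewrite /box/= resE.
    by move=> [Sw Cw]; split => // i; rewrite obsE; exact: Cw.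
  by move=> [Sw Cw]; split => // i _; rewrite /= -obsE.
rewrite (boxE [set t | t <= 0]) (boxE [set t | 0 <= t]).
have sigma_neq0 : sigma != 0 by move: sigma2_gt0; rewrite exprn_even_gt0.
have s_neq0 : `|sigma| != 0 by rewrite normr_eq0.
(* The standard normals representing [h], followed by the noises normalised by [|sigma|]. *)
pose g (l : 'I_r + 'I_m) (w : Om' * Omega) : R :=
  match l with inl j => xi j w.1 | inr i => eps i w.2 / `|sigma| end.
pose B (i : 'I_m) (l : 'I_r + 'I_m) : R :=
  match l with inl j => A (lift ord0 i) j
  | inr i' => if i' == i then `|sigma| else 0 end.
pose c (l : 'I_r + 'I_m) : R :=
  (if l is inl j then A ord0 j else 0) - \sum_i post_weight 0 i * B i l.
have obsE' w i : obs (X' w.1, Y w.2) i = \sum_l B i l * g l w.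
  rewrite /obs !tnth_mktuple /F mxE add0r big_sumType/=; congr (_ + _).
  rewrite (bigD1 i)//= eqxx big1 ?addr0; first by field.
  by move=> i' /negPf ->; rewrite mul0r.
have resE' w : res (X' w.1, Y w.2) = \sum_l c l * g l w.
  rewrite /c; under [RHS]eq_bigr do rewrite mulrBl.
  rewrite sumrB; congr (_ - _).
    rewrite tnth_mktuple /F mxE add0r big_sumType/= [X in _ + X]big1 ?addr0//.
    by move=> i _; rewrite mul0r.
  under [RHS]eq_bigr do rewrite mulr_suml.
  rewrite exchange_big/=; apply: eq_bigr => i _; rewrite obsE' mulr_sumr.
  by apply: eq_bigr => l _; rewrite mulrA.
have boxE' S : (P' \x P)%E [set w | box S (X' w.1, Y w.2)] =
    (P' \x P)%E ([set w | S (\sum_l c l * g l w)] `&`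
      \bigcap_i ((fun w => \sum_l B i l * g l w) @^-1` C i)).
  congr ((P' \x P)%E _); apply/seteqP; split => w; rewrite /box/= resE'.
    by move=> [Sw Cw]; split => // i _; rewrite /= -obsE'.
  by move=> [Sw Cw]; split => // i; rewrite obsE'; exact: Cw.
have AE l l' : \sum_j A l j * A l' j = k (x l) (x l').
  move: AAT => /matrixP/(_ l l'); rewrite !mxE => <-.
  by apply: eq_bigr => j _; rewrite mxE.
(* The covariance matrix of the observations, that is the Gram matrix plus the noise variance on the
   diagonal. *)
have BBE i i' : \sum_l B i l * B i' l =
    k (bs i) (bs i') + (if i == i' then sigma ^+ 2 else 0).
  rewrite big_sumType/= AE !xS; congr (_ + _).
  rewrite (bigD1 i)//= eqxx big1 ?addr0; last first.
    by move=> i0 /negPf ->; rewrite mul0r.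
  by case: ifP => _; rewrite ?mulr0// -expr2 real_normK// num_real.
(* The covariance of observation [i] with the residual: [post_weightE] expands [k (bs i) b] into
   exactly the terms subtracted. *)
have Bc i : \sum_l B i l * c l = 0.
  under eq_bigr do rewrite /c mulrBr.
  rewrite sumrB big_sumType/= AE xS x0 [X in _ + X - _]big1 ?addr0; last first.
    by move=> i' _; rewrite mulr0.
  under [X in _ - X]eq_bigr do rewrite mulr_sumr.
  rewrite exchange_big/= -post_weightE.
  under [X in _ - X]eq_bigr => i' _.
    under eq_bigr do rewrite mulrCA.
    rewrite -mulr_sumr BBE mulrDr (k_psd.1 (bs i)).
    over.
  rewrite big_split/= [X in _ - (_ + X)](bigD1 i)//= eqxx.
  rewrite [X in _ - (_ + (_ + X))]big1 ?addr0 ?subrr// => i' /negPf ii'.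
  by rewrite eq_sym ii' mulr0.
have iidg : iid_normal (P' \x P)%E g.
  split.
    case=> [j|i]; first exact: measurableT_comp.
    by apply: measurable_funM => //; exact: measurableT_comp.
  move=> D mD.
  pose D' i := (fun t : R => t / `|sigma|) @^-1` D (inr i).
  have mD' i : measurable (D' i).
    by apply: measurable_preimage => //; exact: measurable_funM.
  rewrite big_sumType/=.
  transitivity ((P' \x P)%E ((\bigcap_j (xi j @^-1` D (inl j))) `*`
                             (\bigcap_i (eps i @^-1` D' i)))).
    congr ((P' \x P)%E _); apply/seteqP; split => w /=.
      by move=> Dw; split=> i _; [exact: (Dw (inl i))|exact: (Dw (inr i))].
    by move=> [D1w D2w] [j|i] _; [exact: D1w|exact: D2w].
  rewrite product_measure1E//; last 2 first.
  - apply: fin_bigcap_measurable => // j _; exact: measurable_preimage.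
  - apply: fin_bigcap_measurable => // i _; exact: measurable_preimage.
  rewrite [X in (X * _)%E](xi_indep (fun j => D (inl j)))//.
  rewrite [X in (_ * X)%E](eps_indep mD'); congr *%E; apply: eq_bigr => i _.
    exact: xi_normal.
  rewrite -(normal_prob_scale sigma_neq0)//; exact: eps_normal.
rewrite !law; last 2 first.
- by apply: mbox; rewrite -preimage_itvcy; exact: measurable_preimage.
- by apply: mbox; rewrite -preimage_itvNyc; exact: measurable_preimage.
rewrite !boxE'; exact: (half_line_orthogonal iidg).
Qed.

End residual.

(** * The numerical constant and the conditional bound *)

Lemma half_line_bound (R : realType) (eta : R) : 0 < eta ->
  (Num.sqrt (2 * pi))^-1 * expR (- (eta ^+ 2 / 2)) < 2^-1.
Proof.
move=> eta_gt0.
have e1 : expR (- (eta ^+ 2 / 2)) < 1.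
  by rewrite expR_lt1 oppr_lt0 divr_gt0// exprn_gt0.
have s2 : 2 <= Num.sqrt (2 * pi) :> R.
  rewrite -[leLHS]gtr0_norm// -sqrtr_sqr ler_sqrt ?mulr_ge0 ?pi_ge0//.
  by rewrite expr2 ler_pM2l// pi_ge2.
have s_gt0 : 0 < Num.sqrt (2 * pi) :> R by apply: lt_le_trans s2.
apply: (@lt_le_trans _ _ (Num.sqrt (2 * pi))^-1).
  by rewrite gtr_pMr// invr_gt0.
by rewrite lef_pV2// posrE.
Qed.

Theorem corollary1
    (R : realType)
    (S : finType) (S_nonempty : (0 < #|S|)%N)
    (k : belief R S -> belief R S -> R) (k_psd : psd_kernel k)
    (m : nat) (bs : 'I_m -> belief R S)
    (d : measure_display) (Omega : measurableType d) (P : probability Omega R)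
    (h : belief R S -> {RV P >-> R})
    (h_gp : centered_gaussian_process h k)
    (sigma_eps : R) (sigma_eps_gt0 : 0 < sigma_eps ^+ 2)
    (eps : 'I_m -> {RV P >-> R})
    (eps_normal : forall i, normal_rv (eps i) 0 sigma_eps)
    (eps_indep : mutually_independent eps)
    (eps_indep_h : independent_families h eps)
    (v : 'I_m -> {RV P >-> R})
    (v_obs : forall i w, v i w = h (bs i) w + eps i w)
    (eta : R) (eta_gt0 : 0 < eta)
    (b : belief R S) (Q : Omega -> R)
    (Q_cond : is_cond_prob P (sigma_of v)
       [set w | h b w <= ucb k (sigma_eps ^+ 2) eta bs (\col_i v i w) b] Q) :
  {ae P, forall w, (Num.sqrt (2 * pi))^-1 * expR (- (eta ^+ 2 / 2)) <= Q w}.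
Proof.
pose q0 := (Num.sqrt (2 * pi))^-1 * expR (- (eta ^+ 2 / 2)) : R.
have q0_lt : q0 < 2^-1 := half_line_bound eta_gt0.
have [mQ iQ QE] := Q_cond.
pose r := residual k bs h sigma_eps v b.
have mr : measurable_fun setT r by exact: measurable_residual.
pose E1 := [set w | r w <= 0]; pose E2 := [set w | 0 <= r w].
have mE1 : measurable E1.
  by rewrite /E1 -preimage_itvNyc; exact: measurable_preimage.
have mE2 : measurable E2.
  by rewrite /E2 -preimage_itvcy; exact: measurable_preimage.
set E := [set w | _] in QE.
have EE : E = [set w | r w <= eta * post_sd k (sigma_eps ^+ 2) bs b].
  by apply/seteqP; split => w; rewrite /E /r /residual /ucb /= lerBlDl.
have mE : measurable E.
  by rewrite EE -preimage_itvNyc; exact: measurable_preimage.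
have E1E : E1 `<=` E.
  move=> w; rewrite EE /E1 /= => /le_trans; apply.
  by rewrite mulr_ge0 ?sqrtr_ge0// ltW.
(* [A] is the set where the bound fails; it lies in the sigma-algebra of [v] and is shown to be
   null. *)
pose A := Q @^-1` `]-oo, q0[.
have sA : sigma_of v A by exact: mQ.
have mA : measurable A.
  move: A sA; apply: smallest_sub; first exact: sigma_algebra_measurable.
  move=> _ [i _ [B mB <-]]; rewrite setTI; exact: measurable_preimage.
(* Boxes determine finite measures on the sigma-algebra of [v], so the symmetry known on boxes
   extends to [A]. *)
have E12 : P (E1 `&` A) = P (E2 `&` A).
  rewrite setIC [in RHS]setIC.
  apply: (@eq_measure_boxes _ _ _ _ v (mrestr P mE1) (mrestr P mE2)) => //.
    rewrite [ltLHS](_ : _ = P (setT `&` E1))// setTI.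
    by rewrite ltey_eq fin_num_measure.
  move=> B mB.
  transitivity (P (\bigcap_i (v i @^-1` B i) `&` E1)); first by [].
  transitivity (P (\bigcap_i (v i @^-1` B i) `&` E2)); last by [].
  rewrite setIC [in RHS]setIC; exact: residual_symmetric.
(* [E1] and [E2] cover the space and meet [A] with equal probability, and [E1] lies in [E]. *)
have PA : (P A <= P (E `&` A) + P (E `&` A))%E.
  apply: (@le_trans _ _ (P (E1 `&` A) + P (E2 `&` A))%E); last first.
    rewrite -E12; have le1 : (P (E1 `&` A) <= P (E `&` A))%E.
      by apply: le_measure; rewrite ?inE; [exact: measurableI..|exact: setSI].
    exact: leeD.
  apply: (@le_trans _ _ (P ((E1 `&` A) `|` (E2 `&` A)))).
    apply: le_measure; rewrite ?inE//.
      by apply: measurableU; exact: measurableI.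
    move=> w Aw; have [r0|/ltW r0] := leP (r w) 0; [left|right]; split => //.
  by apply: measureU2; exact: measurableI.
(* The probability of [E] within [A] is the integral of [Q] over [A], where [Q] stays below [q0]. *)
have QA : (P (E `&` A) <= q0%:E * P A)%E.
  rewrite -QE// -integral_cst//; apply: le_integral => //.
  - exact: (integrableS measurableT).
  - exact: finite_measure_integrable_cst.
  - by move=> w; rewrite inE /A /= in_itv/= lee_fin => /ltW.
(* The two estimates give [P A <= 2 * q0 * P A] with [2 * q0 < 1]. *)
have PA0 : P A = 0%E.
  have : P A \is a fin_num by rewrite fin_num_measure.
  have : (0 <= P A)%E by [].
  have : (P A <= q0%:E * P A + q0%:E * P A)%E.
    by apply: le_trans PA _; exact: leeD.
  case: (P A) => // p; rewrite -EFinM -EFinD !lee_fin => pq p0 _.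
  by congr EFin; apply/eqP; rewrite eq_le p0 andbT; nra.
exists A; split => // w /=; rewrite /A /= in_itv/=.
by move/negP; rewrite -ltNge.
Qed.
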